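(* Let $P_{\mathrm{det}}=H\cup\overline H$, where $H$ is the set of binary words listed in the context and $\overline H$ is the set of bitwise complements of words in $H$. Then $P_{\mathrm{det}}$ is prefix-free (no word of $P_{\mathrm{det}}$ is a proper prefix of another). Its length profile is $$p_6=8,\quad p_7=14,\quad p_8=12,\quad p_9=12,\quad p_{11}=4,$$ where $p_\ell$ is the number of words of length $\ell$ in $P_{\mathrm{det}}$. Hence its growth parameter $\lambda$ is the unique positive solution of $$8\lambda^{-6}+14\lambda^{-7}+12\lambda^{-8}+12\lambda^{-9}+4\lambda^{-11}=1,$$ so that $\lambda\approx1.6896293138$ and $R(P_{\mathrm{det}})=\log_2\lambda\approx0.756707$. For every $n\ge0$, the code $C_n(P_{\mathrm{det}})=P_{\mathrm{det}}^*\cap\{0,1\}^n$ is detecting, i.e. $B(c)\cap C_n(P_{\mathrm{det}})=\{c\}$ for every $c\in C_n(P_{\mathrm{det}})$. Consequently, $$0.756707\le R_{\mathrm{det},2}\le\tfrac12\log_2 3\approx0.792481 .$$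
   Context: For $c\in\{0,1\}^n$, the radius-one ball $B(c)$ is the set of all words $z=z_1\cdots z_n$ with $z_i=c_{\pi(i)}$ for some permutation $\pi$ of $\{1,\dots,n\}$ satisfying $|\pi(i)-i|\le 1$ for all $i$; equivalently, all words obtained from $c$ by swapping the symbols in any set of pairwise disjoint pairs of adjacent positions. For a finite set $P$ of nonempty binary words, $P^*$ is the set of all finite concatenations (including the empty one) of words in $P$. If $p_\ell$ denotes the number of words of length $\ell$ in $P$ (with $P$ nonempty), the growth parameter of $P$ is the unique positive solution $\lambda$ of $\sum_{\ell\ge1}p_\ell\lambda^{-\ell}=1$, and the rate of $P$ is $R(P)=\log_2\lambda$. A code $C\subseteq\{0,1\}^n$ is detecting if $B(c)\cap C=\{c\}$ for every $c\in C$. $D_2(n)$ is the maximum size of a detecting code in $\{0,1\}^n$, and $R_{\mathrm{det},2}=\limsup_{n\to\infty}\frac1n\log_2 D_2(n)$. The set $H$ consists of the following words. Length 6: 000000, 000111, 001111, 011000. Length 7: 0000111, 0001000, 0111000, 0111111, 0011011, 0011001, 0010011. Length 8: 01111000, 01110011, 01100111, 00100011, 00001100, 00000110. Length 9: 000001111, 000110000, 001110000, 011101111, 011111000, 011101100. Length 11: 00110000111, 01111001111. *)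

(* Defs.v *)
From Stdlib Require String Ascii.
From mathcomp Require Import all_boot all_order all_algebra perm finmap.
From mathcomp Require Import all_classical all_reals all_analysis.

Set Implicit Arguments.
Unset Strict Implicit.
Unset Printing Implicit Defensive.

Import Order.TTheory GRing.Theory Num.Theory.

Local Open Scope fset_scope.
Local Open Scope ring_scope.

Definition log2 {R : realType} (x : R) : R := ln x / ln 2.

(* decimal i [:: d1; d2; ...] is the number with decimal expansion i.d1d2... *)
Definition decimal {R : realType} (i : nat) (ds : seq nat) : R :=
  i%:R + foldr (fun d x => (d%:R + x) / 10) 0 ds.

(* The ball of radius one: z_i = c_(pi i) for a permutation pi moving every
   position by at most one. *)
Definition swap_ball (n : nat) (c : n.-tuple bool) : {set n.-tuple bool} :=
  [set z : n.-tuple bool | [exists pi : {perm 'I_n},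
     [forall i, (pi i <= i.+1)%N && (i <= (pi i).+1)%N] &&
     [forall i, tnth z i == tnth c (pi i)]]]%SET.

Definition detecting (n : nat) (C : {set n.-tuple bool}) : bool :=
  [forall c in C, (swap_ball c :&: C == [set c])%SET].

Definition D2 (n : nat) : nat :=
  (\max_(C : {set n.-tuple bool} | detecting C) #|C|)%N.

(* The upper limit is taken in the extended reals, where it always exists.
   The term of index 0 is irrelevant. *)
Definition Rdet2 (R : realType) : \bar R :=
  limn_esup (fun n => (log2 ((D2 n)%:R : R) / n%:R)%:E).

Definition star (P : {fset bitseq}) (w : bitseq) : Prop :=
  exists2 s : seq bitseq, {subset s <= P} & w = flatten s.

Definition star_code (P : {fset bitseq}) (n : nat) : {set n.-tuple bool} :=
  [set c : n.-tuple bool | `[< star P c >]]%SET.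

Definition prefix_free (P : {fset bitseq}) : Prop :=
  {in P &, forall u v : bitseq, prefix u v -> u = v}.

Definition word_count (P : {fset bitseq}) (l : nat) : nat :=
  #|` [fset w in P | size w == l]|.

Definition growth_equation {R : realType} (P : {fset bitseq}) (x : R) : Prop :=
  \sum_(1 <= l < (\max_(w <- P) size w).+1) (word_count P l)%:R * x ^- l = 1.

(* When P is nonempty and consists of nonempty words, the equation has exactly
   one positive solution, so the default value 0 of xget is not used. *)
Definition growth_param (R : realType) (P : {fset bitseq}) : R :=
  xget 0 [set x : R | 0 < x /\ growth_equation P x]%classic.

Definition rate (R : realType) (P : {fset bitseq}) : R :=
  log2 (growth_param R P).

Fixpoint word_of_string (s : String.string) : bitseq :=
  if s is String.String a s' then
    Ascii.eqb a (Ascii.ascii_of_nat 49) (* the character 1 *)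
      :: word_of_string s'
  else [::].

Import String.StringSyntax.
Local Delimit Scope string_scope with string.

Definition Hdet : {fset bitseq} := [fset w | w in map word_of_string [::
  "000000"; "000111"; "001111"; "011000";
  "0000111"; "0001000"; "0111000"; "0111111"; "0011011"; "0011001"; "0010011";
  "01111000"; "01110011"; "01100111"; "00100011"; "00001100"; "00000110";
  "000001111"; "000110000"; "001110000"; "011101111"; "011111000"; "011101100";
  "00110000111"; "01111001111"]%string].

Definition Pdet : {fset bitseq} := Hdet `|` [fset map negb w | w in Hdet].

(* Main.v *)
(** A word of the ball of [c] is read off [c] by a transducer whose only memory
is the first symbol of a pending swap.  Running it on two concatenations of
codewords, and keeping only the unread part of the current codeword on the side
that is ahead, gives finitely many configurations; a code [P^*] is detecting when
no run that performed a nontrivial swap returns to the empty configuration.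

The rate of [Pdet] is 0.7567067..., which is slightly smaller than 0.756707, so
the lower bound on [Rdet2] is not a consequence of the rate of [Pdet].  It holds
because [Pdet] can be enlarged: adding the word 001100000 leaves the set
prefix-free and detecting and raises the rate to 0.7585....  For the upper bound,
two words that agree, up to order, on each pair of positions 2j, 2j+1 are in each
other's ball, so a detecting code contains at most one word for each of the at
most 3^ceil(n/2) classes.  Binary logarithms are bounded from below by repeated
squaring, and from above through log2 x = 1 - log2 (2 / x). *)

From Stdlib Require Import ZArith.
Require Import Defs.
From mathcomp Require Import all_boot all_order all_algebra perm finmap.
From mathcomp Require Import all_classical all_reals all_analysis.
From mathcomp Require Import zify ring lra ssrZ.
Set Implicit Arguments.
Unset Strict Implicit.
Unset Printing Implicit Defensive.
Import Order.TTheory GRing.Theory Num.Theory.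
Import numFieldNormedType.Exports.
Local Open Scope ring_scope.

(** * The swap transducer *)

(* The first symbol (of [c]) of a pending swap, if any, and whether a swap of two
   distinct symbols has occurred. *)
Definition status : Type := option bool * bool.

(** Exchanging equal symbols changes nothing, so a swap is opened only at a disagreement, which
    makes the transducer deterministic. Over two symbols, [a != x] says that [a] is the symbol
    already read on the [z] side. *)
Definition swap_step (q : status) (a b : bool) : option status :=
  match q with
  | (None, d) => Some (if a == b then (None, d) else (Some a, true))
  | (Some x, d) => if (a != x) && (b == x) then Some (None, d) else None
  end.

Definition config : Type := status * bitseq * bitseq.

Fixpoint swap_run (q : status) (u v : bitseq) : option config :=
  match u, v with
  | a :: u', b :: v' =>
      if swap_step q a b is Some q' then swap_run q' u' v' else None
  | _, _ => Some (q, u, v)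
  end.

Lemma swap_run_cat (q : status) (u v u' v' : bitseq) :
  swap_run q (u ++ u') (v ++ v') =
  if swap_run q u v is Some (q1, u1, v1)
  then swap_run q1 (u1 ++ u') (v1 ++ v') else None.
Proof.
elim: u v q => [|a u IH] [|b v] q //=.
by case: swap_step.
Qed.

Lemma swap_run_nil q u v q' u' v' :
  swap_run q u v = Some (q', u', v') -> u' = [::] \/ v' = [::].
Proof.
elim: u v q => [|a u IH] [|b v] q /=; try by case=> _ <- <-; auto.
by case: swap_step => // q1; apply: IH.
Qed.

Lemma swap_run_dirty x u v q :
  swap_run (x, true) u v = Some (q, [::], [::]) -> q.2.
Proof.
elim: u v x => [|a u IH] [|b v] [x|] //=; try by case=> <-.
- by case: ifP => // _; apply: IH.
- by case: ifP => // _; apply: IH.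
Qed.

Lemma swap_run_clean u v q :
  swap_run (None, false) u v = Some (q, [::], [::]) -> ~~ q.2 -> u = v.
Proof.
elim: u v => [|a u IH] [|b v] //=.
case: eqVneq => [<- /IH H /H <- //|_ /swap_run_dirty ->//].
Qed.

Definition successors (P : seq bitseq) (k : config) : seq config :=
  let: (q, u, v) := k in
  pmap (fun w => if u is [::] then swap_run q w v else swap_run q u w) P.

Definition closed_configs (P : seq bitseq) (K : seq config) : bool :=
  all (fun k => all (fun k' => k' \in K) (successors P k)) K.

(* One of [u] and [v] is always empty between two codewords, so that [successors]
   appends the next codeword on the side that has run out. *)
Lemma closed_configs_run (P : seq bitseq) (K : seq config) (q q' : status)
    (u v : bitseq) (s t : seq bitseq) :
    closed_configs P K -> [::] \notin P ->
    {subset s <= P} -> {subset t <= P} ->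
    (q, u, v) \in K -> u = [::] \/ v = [::] ->
    swap_run q (u ++ flatten s) (v ++ flatten t) = Some (q', [::], [::]) ->
  (q', [::], [::]) \in K.
Proof.
move=> /allP Kcl P0.
(* The induction is on the number of codewords not yet appended on either side. *)
have [n] := ubnP (size s + size t)%N.
elim: n s t q u v => // n IH s t q u v /ltnSE szn sP tP kK uv.
have step w : w \in P -> forall k',
    (if u is [::] then swap_run q w v else swap_run q u w) = Some k' -> k' \in K.
  move=> wP k' Ek'; have /allP := Kcl _ kK; apply.
  by rewrite mem_pmap; apply/mapP; exists w.
have cons_sub w r : {subset w :: r <= P} -> w \in P /\ {subset r <= P}.
  by move=> rP; split=> [|x xr]; apply: rP; rewrite inE ?eqxx ?xr ?orbT.
case: u uv kK step => [|a u] uv kK step.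
  case: s szn sP => [|w s] /= szn sP.
    case: v kK uv step => [|b v] kK uv step /=; last by [].
    case: t tP szn => [|[|b w] t] tP szn; first by case=> <-.
      by have [/(negP P0)] := cons_sub _ _ tP.
    by [].
  have [wP sP'] := cons_sub _ _ sP.
  rewrite /= swap_run_cat; case E : swap_run => [[[q1 u1] v1]|//].
  apply: (IH s t) => //; [exact: step wP _ E|exact: swap_run_nil E].
case: uv kK step => // -> kK step.
case: t tP szn => [|w t] tP szn; first by rewrite /=; case: swap_run.
have [wP tP'] := cons_sub _ _ tP.
rewrite -[[::] ++ flatten (w :: t)]/(w ++ flatten t) swap_run_cat.
case E : swap_run => [[[q1 u1] v1]|//].
apply: (IH s t) => //; [by rewrite -addnS|exact: step wP _ E|exact: swap_run_nil E].
Qed.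

(** A permutation moving every position by at most one is a product of disjoint adjacent
    transpositions, found by scanning from the left. *)
Lemma swap_ball_run n (c z : n.-tuple bool) : z \in swap_ball c ->
  exists d, swap_run (None, false) c z = Some ((None, d), [::], [::]).
Proof.
rewrite inE => /existsP[p /andP[/forallP p_near /forallP/= zE]].
have {}zE i : tnth z i = tnth c (p i) by exact/eqP.
have pinj i j : p i = p j :> nat -> i = j by move=> /val_inj /perm_inj.
(* Invariant of the scan: [p] maps the positions below [k] onto themselves, so [p] sends position
   [k] to [k] or to [k.+1]. *)
suff run k d : (k <= n)%N -> (forall i : 'I_n, (p i < k)%N = (i < k)%N) ->
    exists d', swap_run (None, d) (drop k c) (drop k z) = Some (None, d', [::], [::]).
  by have := run 0%N false isT (fun=> erefl); rewrite !drop0.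
have [m] := ubnP (n - k)%N; elim: m k d => // m IH k d /ltnSE km kn pk.
have dropE (x : n.-tuple bool) j (jn : (j < n)%N) :
    drop j x = tnth x (Ordinal jn) :: drop j.+1 x.
  by rewrite (tnth_nth false) /= -drop_nth ?size_tuple.
move: kn; rewrite leq_eqVlt => /orP[/eqP kn|kn].
  by exists d; rewrite !drop_oversize ?size_tuple ?kn.
have pk0 : (k <= p (Ordinal kn))%N by rewrite leqNgt pk /= ltnn.
have pk1 : (p (Ordinal kn) <= k.+1)%N by have /andP[] := p_near (Ordinal kn).
rewrite (dropE c k kn) (dropE z k kn).
have [pkk|pkk] := eqVneq (p (Ordinal kn) : nat) k.
  have -> : tnth z (Ordinal kn) = tnth c (Ordinal kn).
    by rewrite zE; congr tnth; apply: val_inj.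
  rewrite /= eqxx; apply: IH => //; first by rewrite (leq_trans _ km) ?ltn_sub2l.
  move=> i; rewrite !ltnS [(p i <= k)%N]leq_eqVlt [(i <= k)%N]leq_eqVlt pk; congr orb.
  apply/eqP/eqP => [pik|ik].
    by rewrite (pinj i (Ordinal kn)) // pik pkk.
  by rewrite -pkk; congr (val (p _)); apply: val_inj.
have {}pkk : p (Ordinal kn) = k.+1 :> nat by apply/eqP; rewrite eqn_leq pk1 ltn_neqAle eq_sym pkk.
have k1n : (k.+1 < n)%N by rewrite -pkk.
(* The preimage of [k] is not below [k] by the invariant, is not [k] itself, and is at most
   [k.+1]. *)
have pk1k : p (Ordinal k1n) = k :> nat.
  have pj : p ((p^-1)%g (Ordinal kn)) = k :> nat by rewrite permKV.
  have /andP[j1 j2] := p_near ((p^-1)%g (Ordinal kn)).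
  have j3 : ~~ ((p^-1)%g (Ordinal kn) < k)%N by rewrite -pk pj ltnn.
  have j4 : (p^-1)%g (Ordinal kn) <> k :> nat.
    move=> jk; suff Ej : (p^-1)%g (Ordinal kn) = Ordinal kn
      by move/eqP: pj; rewrite Ej pkk eqn_leq ltnn.
    exact: val_inj.
  suff <- : (p^-1)%g (Ordinal kn) = Ordinal k1n by [].
  apply: val_inj => /=; rewrite pj in j1 j2; move: (val _) j1 j2 j3 j4 => j.
  by clear; lia.
rewrite (dropE c _ k1n) (dropE z _ k1n) !zE.
have -> : p (Ordinal kn) = Ordinal k1n by exact: val_inj.
have -> : p (Ordinal k1n) = Ordinal kn by exact: val_inj.
have IH2 d1 : exists d', swap_run (None, d1) (drop k.+2 c) (drop k.+2 z) =
    Some (None, d', [::], [::]).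
  apply: IH => //; first by rewrite (leq_trans _ km) ?ltn_sub2l.
  move=> i.
  have [ik|ik] := eqVneq (i : nat) k.
    by have -> : i = Ordinal kn by [exact: val_inj]; rewrite pkk /= !ltnS leqnn leqnSn.
  have [ik'|ik'] := eqVneq (i : nat) k.+1.
    by have -> : i = Ordinal k1n by [exact: val_inj]; rewrite pk1k /= !ltnS leqnn leqnSn.
  have pik : p i <> k :> nat.
    by move=> pik; move/eqP: ik'; apply; rewrite (pinj i (Ordinal k1n)) // pik pk1k.
  have pik' : p i <> k.+1 :> nat.
    by move=> pik'; move/eqP: ik; apply; rewrite (pinj i (Ordinal kn)) // pik' pkk.
  move: (pk i) pik pik' => pki /eqP pik /eqP pik'.
  rewrite [(p i < k.+2)%N]ltnS [(i < k.+2)%N]ltnS.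
  rewrite [(p i <= k.+1)%N]leq_eqVlt [(i <= k.+1)%N]leq_eqVlt.
  rewrite [(p i < k.+1)%N]ltnS [(i < k.+1)%N]ltnS [(p i <= k)%N]leq_eqVlt [(i <= k)%N]leq_eqVlt.
  by rewrite pki (negbTE pik) (negbTE pik') (negbTE ik) (negbTE ik').
(* If the two exchanged symbols are equal, the transducer sees two agreements and opens no swap. *)
have [Ecc|Ecc] := eqVneq (tnth c (Ordinal kn)) (tnth c (Ordinal k1n)).
  by rewrite /= Ecc eqxx /= eqxx; exact: IH2.
rewrite /= (negbTE Ecc) /= eq_sym Ecc eqxx.
exact: IH2.
Qed.

Lemma swap_ball_refl n (c : n.-tuple bool) : c \in swap_ball c.
Proof.
rewrite inE; apply/existsP; exists 1%g; apply/andP; split.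
  by apply/forallP => i; rewrite perm1 leqnSn.
by apply/forallP => i; rewrite perm1.
Qed.

Lemma closed_configs_detecting (P : {fset bitseq}) (W : seq bitseq) (K : seq config) n :
    P =i W -> [::] \notin W -> closed_configs W K ->
    (None, false, [::], [::]) \in K -> (None, true, [::], [::]) \notin K ->
  detecting (star_code P n).
Proof.
move=> PW W0 Kcl K0 K1; apply/forall_inP => c; rewrite inE => /asboolP[s sP Ec].
apply/eqP/setP => z; rewrite !inE; apply/andP/eqP => [[]|->]; last first.
  by split; [have := swap_ball_refl c; rewrite inE|apply/asboolP; exists s].
move=> zB /asboolP[t tP Ez].
have [|d run] := @swap_ball_run n c z; first by rewrite inE.
have WP (r : seq bitseq) : {subset r <= P} -> {subset r <= W} by move=> rP x /rP; rewrite PW.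
(* An unflagged run forces [z = c]; a flagged one would put the excluded configuration into [K]. *)
case: d run => run; last by apply/val_inj/esym; exact: swap_run_clean run _.
case/negP: K1; apply: (@closed_configs_run W K (None, false) _ [::] [::] s t) => //.
- exact: WP.
- exact: WP.
- by left.
- by rewrite /= -Ec -Ez.
Qed.

Lemma detecting_sub n (C D : {set n.-tuple bool}) :
  C \subset D -> detecting D -> detecting C.
Proof.
move=> /fintype.subsetP CD /forall_inP detD; apply/forall_inP => c cC.
rewrite finset.eqEsubset; apply/andP; split; last first.
  by rewrite finset.sub1set inE swap_ball_refl.
rewrite -(eqP (detD c (CD c cC))); apply: finset.setIS; exact/fintype.subsetP.
Qed.

(** Worklist search. Its output is only a candidate: [closed_configs] is evaluated on it afterwards,
    so neither its correctness nor the sufficiency of the fuel has to be proved. *)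
Fixpoint reachable (P : seq bitseq) (fuel : nat) (K todo : seq config) : seq config :=
  if fuel is m.+1 then
    if todo is k :: todo' then
      let new := undup [seq k' <- successors P k | k' \notin K] in
      reachable P m (new ++ K) (new ++ todo')
    else K
  else K.

(** * Explicit word lists and the finite checks on them *)

Definition Hdet_words : seq bitseq := ltac:(
  let d := eval unfold Hdet in Hdet in
  match d with context [map word_of_string ?s] =>
    let w := eval vm_compute in (map word_of_string s) in exact w
  end).

Definition Pdet_words : seq bitseq :=
  Hdet_words ++ map (map negb) Hdet_words.

(* Found by a computer search over the words that keep [Pdet] prefix-free. *)
Definition new_word : bitseq :=
  [:: false; false; true; true; false; false; false; false; false].

Definition Qdet_words : seq bitseq := new_word :: Pdet_words.

Definition Qdet : {fset bitseq} := [fset w | w in Qdet_words]%fset.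

Lemma in_Hdet : Hdet =i Hdet_words.
Proof. by move=> w; rewrite in_fset. Qed.

Lemma in_Pdet : Pdet =i Pdet_words.
Proof.
move=> w; rewrite /Pdet in_fsetU mem_cat in_Hdet; congr orb.
apply/imfsetP/mapP => -[v /= vH ->]; exists v => //; first by rewrite -in_Hdet.
by rewrite in_Hdet.
Qed.

Lemma in_Qdet : Qdet =i Qdet_words.
Proof. by move=> w; rewrite in_fset. Qed.

Definition Qdet_configs : seq config :=
  let start := [:: ((None, false), [::], [::])] in
  reachable Qdet_words 200 start start.

Lemma detecting_Qdet n : detecting (star_code Qdet n).
Proof.
apply: (@closed_configs_detecting _ Qdet_words Qdet_configs) => //; exact: in_Qdet.
Qed.

(** Detection passes to subcodes, so the search made for [Qdet] serves here as well. *)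
Lemma detecting_Pdet n : detecting (star_code Pdet n).
Proof.
apply: detecting_sub (detecting_Qdet n); apply/fintype.subsetP => c.
rewrite inE => /asboolP[s sP cE]; rewrite inE; apply/asboolP; exists s => [w /sP|//].
by rewrite in_Pdet in_Qdet; apply: (@mem_behead _ Qdet_words).
Qed.

Lemma prefix_free_seq (P : {fset bitseq}) (W : seq bitseq) : P =i W ->
    all (fun u => all (fun v => prefix u v ==> (u == v)) W) W ->
  prefix_free P.
Proof.
move=> PW /allP WW u v; rewrite !PW => uW vW uv.
by have /allP/(_ v vW) := WW u uW; rewrite uv => /eqP.
Qed.

Lemma prefix_free_Qdet : prefix_free Qdet.
Proof. by apply: (prefix_free_seq in_Qdet); vm_compute. Qed.

Lemma prefix_free_Pdet : prefix_free Pdet.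
Proof. by apply: (prefix_free_seq in_Pdet); vm_compute. Qed.

Lemma big_fset_seq (T : Type) (idx : T) (op : Monoid.com_law idx)
    (P : {fset bitseq}) (W : seq bitseq) (F : bitseq -> T) : P =i W -> uniq W ->
  \big[op/idx]_(w <- P) F w = \big[op/idx]_(w <- W) F w.
Proof. by move=> PW W_uniq; apply: perm_big; apply: uniq_perm. Qed.

Lemma word_count_seq (P : {fset bitseq}) (W : seq bitseq) l : P =i W -> uniq W ->
  word_count P l = count (fun w => size w == l) W.
Proof.
move=> PW W_uniq; rewrite -size_filter; apply: perm_size; apply: uniq_perm => //.
  exact: filter_uniq.
by move=> w; rewrite !inE mem_filter PW andbC.
Qed.

(** * Growth of star codes *)

Lemma star_cat P u v : star P u -> star P v -> star P (u ++ v).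
Proof.
move=> [s sP ->] [t tP ->]; exists (s ++ t); last by rewrite flatten_cat.
by move=> w; rewrite mem_cat => /orP[/sP|/tP].
Qed.

Lemma prefix_free_cat (P : {fset bitseq}) u v x y : prefix_free P ->
  u \in P -> v \in P -> u ++ x = v ++ y -> u = v.
Proof.
move=> pfP; wlog uv : u v x y / (size u <= size v)%N.
  move=> H uP vP E; have [uv|/ltnW uv] := leqP (size u) (size v); first exact: H E.
  exact/esym/(H _ _ _ _ uv vP uP (esym E)).
move=> uP vP E; apply: pfP => //.
by rewrite prefixE -(takel_cat y uv) -E take_size_cat.
Qed.

(** By prefix-freeness the first codeword of [w ++ x] is determined, so prepending [w] to the words
    of length [n - size w] is injective over all pairs. *)
Lemma leq_sum_star_code (P : {fset bitseq}) n : prefix_free P ->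
    (forall w, w \in P -> (size w <= n)%N) ->
  (\sum_(w <- P) #|star_code P (n - size w)| <= #|star_code P n|)%N.
Proof.
move=> pfP szP.
(* Tuples of different lengths have different types; their underlying words are collected in lists
   instead. *)
pose L m : seq bitseq := [seq val c | c <- enum (star_code P m)].
have szL m : size (L m) = #|star_code P m| by rewrite size_map cardE.
have inL m x : reflect (star P x /\ size x = m) (x \in L m).
  apply: (iffP mapP) => [[c]|[Px xm]].
    by rewrite mem_enum inE => /asboolP Pc ->; rewrite size_tuple.
  have sx : size x == m by apply/eqP.
  by exists (Tuple sx) => //; rewrite mem_enum inE; apply/asboolP.
rewrite -szL; under eq_bigr do rewrite -szL.
have -> : (\sum_(w <- P) size (L (n - size w)) =
    size [seq w ++ x | w <- P, x <- L (n - size w)])%N.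
  by rewrite size_allpairs_dep sumnE big_map.
apply: uniq_leq_size.
  apply: allpairs_uniq_dep; first exact: fset_uniq.
    by move=> w _; rewrite map_inj_uniq ?enum_uniq//; exact: val_inj.
  move=> /= _ _ /allpairsPdep[u [x [uP _ ->]]] /allpairsPdep[v [y [vP _ ->]]] /= E.
  have Euv := prefix_free_cat pfP uP vP E; move: E; rewrite Euv => /eqP.
  by rewrite eqseq_cat // eqxx /= => /eqP ->.
move=> _ /allpairsPdep[w [x [wP /inL[Px sx] ->]]]; apply/inL; split.
  by apply: star_cat => //; exists [:: w]; rewrite /= ?cats0// => ? /[!inE]/eqP ->.
by rewrite size_cat sx subnKC // szP.
Qed.

(** Strong induction on [n] through [leq_sum_star_code]: the bounds for the shorter lengths add up
    to the bound for [n] because the inverse powers of [mu] sum to at least 1. *)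
Lemma star_code_growth (R : realType) (P : {fset bitseq}) (N : nat) (mu : R) :
    prefix_free P -> [::] \notin P ->
    (forall n, (N <= n)%N -> (0 < #|star_code P n|)%N) ->
    1 <= mu -> 1 <= \sum_(w <- P) mu ^- size w ->
  exists2 c, 0 < c & forall n, (N <= n)%N -> c * mu ^+ n <= #|star_code P n|%:R.
Proof.
move=> pfP P0 posP mu1 sum1; have mu0 : 0 < mu by exact: lt_le_trans mu1.
pose M := (\max_(w <- P) size w)%N.
have szM w : w \in P -> (size w <= M)%N by move=> wP; exact: leq_bigmax_seq.
(* With this constant the bound is at most 1 for [n < N + M], where nonemptiness suffices; for
   larger [n], all lengths [n - size w] are still at least [N]. *)
exists (mu ^- (N + M)) => [|n]; first by rewrite invr_gt0 exprn_gt0.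
have [m] := ubnP n; elim: m n => // m IH n /ltnSE nm Nn.
have [nNM|NMn] := ltnP n (N + M).
  rewrite (@le_trans _ _ 1) //; last by rewrite ler1n posP.
  rewrite mulrC ler_pdivrMr ?exprn_gt0 // mul1r.
  by rewrite ler_weXn2l // ltnW.
have Mn : (M <= n)%N by rewrite (leq_trans _ NMn) // leq_addl.
have szP w : w \in P -> (size w <= n)%N by move=> /szM /leq_trans; apply.
apply: (@le_trans _ _ (\sum_(w <- P) #|star_code P (n - size w)|)%:R); last first.
  by rewrite ler_nat leq_sum_star_code.
rewrite natr_sum -[leLHS]mulr1.
apply: (@le_trans _ _ (mu ^- (N + M) * mu ^+ n * \sum_(w <- P) mu ^- size w)).
  by rewrite ler_wpM2l // mulr_ge0 // ?invr_ge0 exprn_ge0 // ltW.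
rewrite mulr_sumr big_seq [leRHS]big_seq; apply: ler_sum => w wP.
have w0 : (0 < size w)%N by case: w wP => // wP; case/negP: P0.
rewrite -mulrA -expfB_cond ?gt_eqF //=; last by rewrite szP.
apply: IH; last by rewrite leq_subRL ?szP // addnC (leq_trans _ NMn) // leq_add2l szM.
by rewrite (leq_trans _ nm) // ltn_subrL w0 (leq_trans w0) // szP.
Qed.

(** * From code sizes to the upper limit *)

Lemma le_limn_esup_from (R : realType) (u v : (\bar R)^nat) (N : nat) :
    (forall n, (N <= n)%N -> (u n <= v n)%E) ->
  (limn_esup u <= limn_esup v)%E.
Proof.
move=> uv; rewrite !limn_esup_lim; apply: lee_lim; [exact: is_cvg_esups..|].
exists N => //= n /= Nn; apply: ge_ereal_sup => _ [k /= nk <-].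
apply: le_trans (uv k (leq_trans Nn nk)) _.
by apply: ereal_sup_ubound; exists k.
Qed.

(** The logarithm of [c * mu ^+ n], divided by [n], has this shape, with [a] the logarithm of
    [c]. *)
Lemma cvg_affine_over_n (R : realType) (a b : R) :
  ((a * n%:R^-1 + b)%:E @[n --> \oo] --> b%:E)%classic.
Proof.
have inv0 : ((fun n : nat => n%:R^-1 : R) @ \oo --> (0 : R))%classic.
  apply/gtr0_cvgV0; last exact: cvgr_idn.
  by exists 1%N => //= n /= n0; rewrite ltr0n.
apply: cvg_EFin; first exact: nearW.
rewrite -[X in (_ --> X)%classic]add0r -[X in (_ --> X + _)%classic](mulr0 a).
apply: cvgD; last exact: cvg_cst.
exact: cvgM (cvg_cst a) inv0.
Qed.

Lemma log2M (R : realType) (x y : R) : 0 < x -> 0 < y ->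
  log2 (x * y) = log2 x + log2 y.
Proof. by move=> x0 y0; rewrite /log2 lnM // mulrDl. Qed.

Lemma log2X (R : realType) (x : R) n : 0 < x -> log2 (x ^+ n) = n%:R * log2 x.
Proof. by move=> x0; rewrite /log2 lnXn // -[ln x *+ n]mulr_natl mulrA. Qed.

Lemma ln2_gt0 (R : realType) : 0 < ln 2 :> R.
Proof. by rewrite ln_gt0 // ltr1n. Qed.

Lemma ler_log2 (R : realType) (x y : R) : 0 < x -> x <= y -> log2 x <= log2 y.
Proof.
move=> x0 xy; rewrite ler_pM2r ?invr_gt0 ?ln2_gt0 // ler_ln //.
by rewrite posrE (lt_le_trans x0).
Qed.

Lemma log2_2 (R : realType) : log2 2 = 1 :> R.
Proof. by rewrite /log2 divff // gt_eqF // ln2_gt0. Qed.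

Lemma leq_card_D2 n (C : {set n.-tuple bool}) : detecting C -> (#|C| <= D2 n)%N.
Proof. by move=> detC; rewrite /D2; exact: leq_bigmax_cond. Qed.

Lemma Rdet2_ge (R : realType) (P : {fset bitseq}) (N : nat) (mu : R) :
    prefix_free P -> [::] \notin P -> (forall n, detecting (star_code P n)) ->
    (forall n, (N <= n)%N -> (0 < #|star_code P n|)%N) ->
    1 <= mu -> 1 <= \sum_(w <- P) mu ^- size w ->
  ((log2 mu)%:E <= Rdet2 R)%E.
Proof.
move=> pfP P0 detP posP mu1 sum1; have mu0 : 0 < mu by exact: lt_le_trans mu1.
have [c c0 cP] := star_code_growth pfP P0 posP mu1 sum1.
have [_ <-] := cvg_limn_einf_sup (@cvg_affine_over_n R (log2 c) (log2 mu)).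
(* Starting at [N.+1] rather than [N] excludes the division by [n = 0]. *)
apply: (@le_limn_esup_from _ _ _ N.+1) => n Nn; rewrite lee_fin.
have n0 : 0 < n%:R :> R by rewrite ltr0n (leq_trans _ Nn).
rewrite ler_pdivlMr // mulrDl divfK ?gt_eqF // [log2 mu * _]mulrC -log2X // -log2M // ?exprn_gt0 //.
apply: ler_log2; first by rewrite mulr_gt0 // exprn_gt0.
by rewrite (le_trans (cP n (ltnW Nn))) // ler_nat leq_card_D2.
Qed.

Lemma D2_gt0 n : (0 < D2 n)%N.
Proof.
pose c : n.-tuple bool := nseq_tuple n false.
apply: (@leq_trans #|[set c]%SET|); first by rewrite cards1.
apply: leq_card_D2; apply/forall_inP => x /set1P ->.
by apply/eqP/finset.setIidPr; rewrite finset.sub1set swap_ball_refl.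
Qed.

(** Squaring keeps the exponents integral; the constant [k] absorbs the rounding of [n / 2] and
    vanishes in the limit. *)
Lemma Rdet2_le (R : realType) (b : R) (k : nat) :
    0 < b -> (forall n, ((D2 n)%:R : R) ^+ 2 <= b ^+ (n + k)) ->
  (Rdet2 R <= (1 / 2 * log2 b)%:E)%E.
Proof.
move=> b0 D2b.
have [_ <-] := cvg_limn_einf_sup (@cvg_affine_over_n R (k%:R / 2 * log2 b) (1 / 2 * log2 b)).
apply: (@le_limn_esup_from _ _ _ 1) => n n0; rewrite lee_fin.
have n0' : 0 < n%:R :> R by rewrite ltr0n.
have D0 : 0 < (D2 n)%:R :> R by rewrite ltr0n D2_gt0.
have : log2 ((D2 n)%:R ^+ 2 : R) <= log2 (b ^+ (n + k)).
  by apply: ler_log2; rewrite ?exprn_gt0.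
rewrite !log2X // natrD => H.
rewrite ler_pdivrMr // mulrDl divfK ?gt_eqF //.
by lra.
Qed.

(** * The upper bound *)

(** The other element of the pair of positions 2j, 2j+1. For odd [n] the partner of the last
    position is [n], which is out of range. *)
Definition partner (k : nat) : nat := if odd k then k.-1 else k.+1.

Lemma partnerK : involutive partner.
Proof. by move=> k; rewrite /partner; do 2 case: ifP; lia. Qed.

Lemma partner_near k : (partner k <= k.+1)%N && (k <= (partner k).+1)%N.
Proof. by rewrite /partner; case: ifP; lia. Qed.

(* The symbols in positions 2j and 2j+1, up to order; the missing partner of
   the last position when n is odd counts as 0. *)
Definition pair_weights n (c : n.-tuple bool) : {ffun 'I_(uphalf n) -> 'I_3} :=
  [ffun j : 'I_(uphalf n) => inord (nth false c j.*2 + nth false c j.*2.+1)%N].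

(** Two words with the same sum on a pair that differ there read 01 and 10 on it, so their symbols
    are crossed. *)
Lemma pair_weights_partner n (x y : n.-tuple bool) (i : 'I_n) :
    pair_weights x = pair_weights y -> tnth y i != tnth x i ->
  nth false x (partner i) = tnth y i /\ nth false y (partner i) = tnth x i.
Proof.
move=> xy; rewrite !(tnth_nth false) /=.
have jn : (i./2 < uphalf n)%N by have := ltn_ord i; move: (val i) => k; clear; lia.
have : (nth false x (i./2).*2 + nth false x (i./2).*2.+1 =
       nth false y (i./2).*2 + nth false y (i./2).*2.+1)%N.
  have /(congr1 val) := congr1 (fun f : {ffun _ -> _} => f (Ordinal jn)) xy.
  have lt3 (a b : bool) : (a + b < 3)%N by case: a; case: b.
  by rewrite !ffunE /= !inordK.
rewrite /partner; move: (nat_of_ord i) => k; have := odd_double_half k.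
move: (odd k) (k./2) => b h <-.
by case: b; rewrite ?add1n ?add0n /=; case: (nth _ x h.*2); case: (nth _ x h.*2.+1);
  case: (nth _ y h.*2); case: (nth _ y h.*2.+1).
Qed.

Lemma pair_weights_swap_ball n (x y : n.-tuple bool) :
  pair_weights x = pair_weights y -> y \in swap_ball x.
Proof.
move=> xy.
pose f (i : 'I_n) := if tnth y i == tnth x i then i else insubd i (partner i).
have fP (i : 'I_n) : tnth y i != tnth x i -> f i = partner i :> nat.
  move=> yx; rewrite /f (negbTE yx) val_insubd; case: ltnP => // n_le.
  have [] := pair_weights_partner xy yx.
  rewrite !nth_default ?size_tuple // => yi xi.
  by move: yx; rewrite -yi -xi.
have fK : involutive f.
  move=> i; have [yx|yx] := eqVneq (tnth y i) (tnth x i); first by rewrite /f yx eqxx yx eqxx.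
  have [E1 E2] := pair_weights_partner xy yx.
  apply: val_inj; rewrite /= fP; first by rewrite fP // partnerK.
  by rewrite !(tnth_nth false) fP // E1 E2 eq_sym.
rewrite inE; apply/existsP; exists (perm (inv_inj fK)); apply/andP; split; apply/forallP => i.
  rewrite permE; have [yx|yx] := eqVneq (tnth y i) (tnth x i).
    by rewrite /f yx eqxx leqnSn.
  by rewrite fP // partner_near.
rewrite permE; have [yx|yx] := eqVneq (tnth y i) (tnth x i).
  by rewrite /f yx eqxx.
have [E1 _] := pair_weights_partner xy yx.
by rewrite (tnth_nth false x) fP // E1.
Qed.

Lemma D2_le n : (D2 n <= 3 ^ uphalf n)%N.
Proof.
apply/bigmax_leqP => C /forall_inP detC.
have inj : {in C &, injective (@pair_weights n)}.
  move=> x y xC yC xy; have := pair_weights_swap_ball xy => yx.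
  have : y \in (swap_ball x :&: C)%SET by rewrite finset.in_setI yx yC.
  by rewrite (eqP (detC x xC)) => /set1P.
rewrite -(card_in_imset inj) (leq_trans (max_card _)) //.
by rewrite card_ffun !card_ord.
Qed.

Lemma Rdet2_le_log3 (R : realType) : (Rdet2 R <= (1 / 2 * log2 (3 : R))%:E)%E.
Proof.
(* The shift 1 comes from [2 * uphalf n <= n + 1]. *)
apply: (@Rdet2_le _ _ 1) => // n.
rewrite -!natrX ler_nat (@leq_trans ((3 ^ uphalf n) ^ 2)%N) //.
  by rewrite leq_exp2r // D2_le.
by rewrite -expnM leq_pexp2l //; clear; lia.
Qed.

(** * Certified numerical bounds *)

(* Binary integers, so that comparisons of large powers can be computed. *)
Definition zr (R : realType) (a : Z) : R := (int_of_Z a)%:~R.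
Arguments zr R a%_ring_scope.

Lemma zrD (R : realType) (a b : Z) : zr R (a + b) = zr R a + zr R b.
Proof. by rewrite /zr !rmorphD. Qed.

Lemma zrM (R : realType) (a b : Z) : zr R (a * b) = zr R a * zr R b.
Proof. by rewrite /zr !rmorphM. Qed.

Lemma zrX (R : realType) (a : Z) n : zr R (a ^+ n) = zr R a ^+ n.
Proof. by rewrite /zr !rmorphXn. Qed.

Lemma zr_nat (R : realType) n : zr R n%:R = n%:R.
Proof. by rewrite /zr !rmorph_nat. Qed.

Lemma zr0 (R : realType) : zr R 0 = 0.
Proof. by rewrite /zr !rmorph0. Qed.

Lemma zr1 (R : realType) : zr R 1 = 1.
Proof. by rewrite /zr !rmorph1. Qed.

Lemma zr_of_nat (R : realType) n : zr R (Z.of_nat n) = n%:R.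
Proof. by rewrite -zr_nat; congr zr; lia. Qed.

Lemma ler_zr (R : realType) (a b : Z) : a <= b -> zr R a <= zr R b.
Proof.
rewrite /zr ler_int -[a in a <= _]int_of_ZK -[b in _ <= b]int_of_ZK.
by rewrite !ssrZ.Instances.Z_of_intE ler_int.
Qed.

Lemma zr_gt0 (R : realType) (a : Z) : 0 < a -> 0 < zr R a.
Proof. by rewrite /zr ltr0z -[a in _ < a]int_of_ZK ssrZ.Instances.Z_of_intE ltr0z. Qed.

Definition decimal_num (i : nat) (ds : seq nat) : Z :=
  foldl (fun (a : Z) (d : nat) => 10 * a + Z.of_nat d) (Z.of_nat i) ds.

(** [decimal] folds from the last digit, [decimal_num] from the first; generalising the integer part
    turns it into the accumulator of the induction. *)
Lemma decimalE (R : realType) i ds :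
  decimal i ds = zr R (decimal_num i ds) / zr R (10 ^+ size ds).
Proof.
rewrite /decimal /decimal_num -zr_of_nat; elim: ds (Z.of_nat i) => [|d ds IH] a.
  by rewrite /= addr0 expr0 zr1 divr1.
have {IH} := IH (10 * a + Z.of_nat d); rewrite zrD zrM zr_of_nat (zr_nat R 10) => E.
rewrite [foldr _ _ _]/= [size _]/= exprS zrM (zr_nat R 10) invfM [10^-1 * _]mulrC mulrA.
transitivity ((10 * zr R a + d%:R + foldr (fun d x => (d%:R + x) / 10) 0 ds) / 10).
  by field.
by rewrite E.
Qed.

Lemma mul_Zdiv_le (a b : Z) : 0 < b -> b * Z.div a b <= a.
Proof. by move=> /Z.ltb_lt b0; apply/Z.leb_le; exact: Z.mul_div_le. Qed.

Lemma le_Zdiv (a b q : Z) : 0 < b -> b * q <= a -> q <= Z.div a b.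
Proof. by move=> /Z.ltb_lt b0 /Z.leb_le H; apply/Z.leb_le; exact: Z.div_le_lower_bound. Qed.

(** One squaring step: [k] is the extracted binary digit and [y] a lower approximation of the
    rescaled square. *)
Lemma log2_sqr_ge (R : realType) (x y : R) (k : nat) : 0 < x -> 0 < y ->
  2 ^+ k * y <= x ^+ 2 -> (k%:R + log2 y) / 2 <= log2 x.
Proof.
move=> x0 y0 /ler_log2; rewrite mulr_gt0 ?exprn_gt0 // => /(_ isT).
by rewrite log2M ?exprn_gt0 // !log2X // log2_2 mulr1; lra.
Qed.

(* The first [n] binary digits of log2 (a / s), for 1 <= a / s < 2, read as an
   integer: squaring shifts the logarithm by one digit.  Rounding the squares
   down keeps the numerators below 2 * s. *)
Fixpoint log2_digits (s : Z) (n : nat) (a : Z) : Z :=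
  if n is m.+1 then
    if 2 * s * s <= a * a
    then 2 ^+ m + log2_digits s m (Z.div (a * a) (2 * s))
    else log2_digits s m (Z.div (a * a) s)
  else 0.

(** Rounding down only lowers the estimate, and each quotient stays at least [s], so the remaining
    logarithm is nonnegative when the digits run out. *)
Lemma log2_digits_le (R : realType) (s a : Z) n : 0 < s -> s <= a ->
  zr R (log2_digits s n a) / 2 ^+ n <= log2 (zr R a / zr R s).
Proof.
move=> s0; have sR := zr_gt0 R s0.
have frac_gt0 b : s <= b -> 0 < zr R b / zr R s.
  by move=> sb; rewrite divr_gt0 // (lt_le_trans sR) // ler_zr.
have sqr_ge (c b : Z) k : 2 ^+ k * s * b <= c * c ->
    2 ^+ k * (zr R b / zr R s) <= (zr R c / zr R s) ^+ 2.
  move=> /(ler_zr R) H; rewrite expr_div_n ler_pdivlMr ?exprn_gt0 //.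
  suff -> : 2 ^+ k * (zr R b / zr R s) * zr R s ^+ 2 = zr R (2 ^+ k * s * b).
    by rewrite expr2 -zrM.
  by rewrite !zrM zrX (zr_nat R 2); field; rewrite gt_eqF.
have halve m (d : R) : d / 2 ^+ m.+1 = d / 2 ^+ m / 2 by rewrite exprSr invfM mulrA.
elim: n a => [|n IH] a sa /=.
  rewrite zr0 mul0r /log2 divr_ge0 ?ln_ge0 ?ler_pdivlMr ?mul1r ?ler_zr //.
  by rewrite ler1n.
have s20 : 0 < 2 * s by rewrite mulr_gt0.
case: ifPn => [ss|_].
  have sa' := le_Zdiv s20 ss.
  apply: le_trans (log2_sqr_ge (k := 1) (frac_gt0 _ sa) (frac_gt0 _ sa') _); last first.
    by apply: sqr_ge; rewrite expr1; exact: mul_Zdiv_le.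
  rewrite zrD zrX (zr_nat R 2) halve ler_pM2r ?invr_gt0 //.
  by rewrite mulrDl divff ?expf_neq0 // lerD2l IH.
have sa' : s <= Z.div (a * a) s by apply: le_Zdiv => //; apply: ler_pM => //; exact: ltW.
apply: le_trans (log2_sqr_ge (k := 0) (frac_gt0 _ sa) (frac_gt0 _ sa') _); last first.
  by apply: sqr_ge; rewrite expr0 mul1r; exact: mul_Zdiv_le.
by rewrite add0r halve ler_pM2r ?invr_gt0 // IH.
Qed.

(** Both hypotheses compare binary integers, so they are settled by evaluation. *)
Lemma decimal_le_log2 (R : realType) (i : nat) (ds ds' : seq nat) (n : nat) :
    let s : Z := 10 ^+ size ds in let a := decimal_num i ds in
    s <= a ->
    decimal_num 0 ds' * 2 ^+ n <= log2_digits s n a * 10 ^+ size ds' ->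
  decimal 0 ds' <= log2 (decimal i ds) :> R.
Proof.
move=> s a sa /(ler_zr R) H; have s0 : 0 < s by rewrite exprn_gt0.
rewrite !decimalE; apply: le_trans (log2_digits_le R n s0 sa).
rewrite ler_pdivrMr; last by apply: zr_gt0; rewrite exprn_gt0.
rewrite mulrAC ler_pdivlMr ?exprn_gt0 //.
by move: H; rewrite !zrM (zrX R 2) (zr_nat R 2).
Qed.

(* The padding digits set the precision of [log2_digits]. *)
Lemma log2_3_bounds (R : realType) :
  decimal 1 [:: 5; 8; 4; 9; 6; 2]%N <= log2 (3 : R) <= decimal 1 [:: 5; 8; 4; 9; 6; 3]%N.
Proof.
(* [x] is 3/2, for the lower bound; [y] is just below 4/3, so that [log2 3 <= 2 - log2 y]. *)
pose x : R := decimal 1 [:: 5; 0; 0; 0; 0; 0; 0; 0; 0; 0; 0; 0]%N.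
pose y : R := decimal 1 [:: 3; 3; 3; 3; 3; 3; 3; 3; 3; 3; 3; 3]%N.
have x_ge : decimal 0 [:: 5; 8; 4; 9; 6; 2]%N <= log2 x.
  by apply: (@decimal_le_log2 _ _ _ _ 24); vm_compute.
have y_ge : decimal 0 [:: 4; 1; 5; 0; 3; 7]%N <= log2 y.
  by apply: (@decimal_le_log2 _ _ _ _ 24); vm_compute.
have x0 : 0 < x by rewrite /x /decimal /=; lra.
have y0 : 0 < y by rewrite /y /decimal /=; lra.
apply/andP; split.
  have -> : 3 = 2 * x by rewrite /x /decimal /=; lra.
  by rewrite log2M // log2_2; move: (log2 x) x_ge => l; rewrite /decimal /=; lra.
have y3 : y * 3 <= 2 ^+ 2 by rewrite /y /decimal /=; lra.
have y30 : 0 < y * 3 by rewrite mulr_gt0.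
have := ler_log2 y30 y3.
rewrite log2M // log2X // log2_2; move: (log2 y) (log2 3) y_ge => l m.
by rewrite /decimal /=; lra.
Qed.

Lemma half_log2_3 (R : realType) :
  `|1 / 2 * log2 (3 : R) - decimal 0 [:: 7; 9; 2; 4; 8; 1]%N| <= 5 / 10 ^+ 7.
Proof.
have /andP[] := log2_3_bounds R; rewrite ler_norml; move: (log2 _) => l.
by rewrite /decimal /= => h1 h2; apply/andP; split; lra.
Qed.

(** * The growth parameter *)

Lemma sum_by_size (R : realType) (W : seq bitseq) (L : seq nat) (f : nat -> R) :
    uniq L -> all (fun w => size w \in L) W ->
  \sum_(w <- W) f (size w) =
  \sum_(l <- L) (count (fun w => size w == l) W)%:R * f l.
Proof.
move=> L_uniq; elim: W => [|w W IH] /=.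
  by rewrite big_nil big1 // => l _; rewrite mul0r.
case/andP=> wL /IH E; rewrite big_cons E.
under [RHS]eq_bigr do rewrite natrD mulrDl.
rewrite big_split /=; congr (_ + _).
rewrite (bigD1_seq (size w)) //= eqxx mul1r big1 ?addr0 // => l.
by rewrite eq_sym => /negbTE ->; rewrite mul0r.
Qed.

(** The sum over lengths starts at 1 and would miss the empty word. *)
Lemma growth_equationE (R : realType) (P : {fset bitseq}) (x : R) : [::] \notin P ->
  growth_equation P x <-> \sum_(w <- P) x ^- size w = 1.
Proof.
move=> P0; rewrite (@sum_by_size _ _ (index_iota 1 (\max_(w <- P) size w).+1) (fun l => x ^- l)).
- have wcE l := @word_count_seq P (enum_fset P) l (fun=> erefl) (fset_uniq P).
  by rewrite (eq_bigr (fun l => (word_count P l)%:R * x ^- l)) // => l _; rewrite wcE.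
- exact: iota_uniq.
apply/allP => w wP; rewrite mem_index_iota ltnS; apply/andP; split.
  by case: w wP => // wP; case/negP: P0.
exact: leq_bigmax_seq.
Qed.

Lemma sum_Pdet (R : realType) (x : R) : \sum_(w <- Pdet) x ^- size w =
  8 * x ^- 6 + 14 * x ^- 7 + 12 * x ^- 8 + 12 * x ^- 9 + 4 * x ^- 11.
Proof.
rewrite (big_fset_seq _ _ in_Pdet) //.
rewrite (@sum_by_size _ _ [:: 6; 7; 8; 9; 11]%N (fun l => x ^- l)) //.
by rewrite !big_cons big_nil addr0 !addrA.
Qed.

Lemma sum_Qdet (R : realType) (x : R) :
  \sum_(w <- Qdet) x ^- size w = x ^- 9 + \sum_(w <- Pdet) x ^- size w.
Proof. by rewrite (big_fset_seq _ _ in_Qdet) // (big_fset_seq _ _ in_Pdet) // big_cons. Qed.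

Lemma sum_Pdet_frac (R : realType) (x : R) : 0 < x -> \sum_(w <- Pdet) x ^- size w =
  (8 * x ^+ 5 + 14 * x ^+ 4 + 12 * x ^+ 3 + 12 * x ^+ 2 + 4) / x ^+ 11.
Proof. by move=> x0; rewrite sum_Pdet; field; rewrite gt_eqF. Qed.

(** Strict monotonicity is what makes the positive solution unique. *)
Lemma sum_Pdet_lt (R : realType) (x y : R) : 0 < x -> x < y ->
  \sum_(w <- Pdet) y ^- size w < \sum_(w <- Pdet) x ^- size w.
Proof.
move=> x0 xy; rewrite !sum_Pdet.
have y0 : 0 < y by exact: lt_trans xy.
have ltV n : y ^- n.+1 < x ^- n.+1.
  by rewrite ltf_pV2 ?posrE ?exprn_gt0 // ltrXn2r // ltW.
by rewrite !ltrD // ltr_pM2l.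
Qed.

Lemma sum_Pdet_inj (R : realType) (x y : R) : 0 < x -> 0 < y ->
  \sum_(w <- Pdet) x ^- size w = \sum_(w <- Pdet) y ^- size w -> x = y.
Proof.
move=> x0 y0 E; case: (ltgtP x y) => // [/(sum_Pdet_lt x0)|/(sum_Pdet_lt y0)];
  by rewrite E ltxx.
Qed.

(** [lambda_lo] and [lambda_hi] bound the interval of radius 5 / 10^11 around 1.6896293138. *)
Definition lambda_lo : seq nat := [:: 6; 8; 9; 6; 2; 9; 3; 1; 3; 7; 5]%N.
Definition lambda_hi : seq nat := [:: 6; 8; 9; 6; 2; 9; 3; 1; 3; 8; 5]%N.

Lemma exists_root_Pdet (R : realType) : exists2 x : R,
  decimal 1 lambda_lo <= x <= decimal 1 lambda_hi &
  0 < x /\ \sum_(w <- Pdet) x ^- size w = 1.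
Proof.
(* The growth equation multiplied by [x ^+ 11]; its root comes from the intermediate value
   theorem. *)
pose p : {poly R} := 'X^11 - 8 *: 'X^5 - 14 *: 'X^4 - 12 *: 'X^3 - 12 *: 'X^2 - 4%:P.
have pE x : p.[x] = x ^+ 11 - (8 * x ^+ 5 + 14 * x ^+ 4 + 12 * x ^+ 3 + 12 * x ^+ 2 + 4).
  by rewrite /p !(hornerD, hornerN, hornerZ, hornerXn, hornerC); ring.
have lo1 : 1 <= decimal 1 lambda_lo :> R by rewrite /decimal /=; lra.
(* The homogenised polynomial [b ^+ 11 * p (a / b)]: the sign of [p] at a rational point becomes an
   integer comparison. *)
pose num (a b : Z) : Z := a ^+ 11 - (8 * a ^+ 5 * b ^+ 6 + 14 * a ^+ 4 * b ^+ 7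
  + 12 * a ^+ 3 * b ^+ 8 + 12 * a ^+ 2 * b ^+ 9 + 4 * b ^+ 11).
have pE_frac (a b : Z) : 0 < b -> p.[zr R a / zr R b] = zr R (num a b) / zr R b ^+ 11.
  move=> /(zr_gt0 R) b0; rewrite pE /num; rewrite /zr in b0 *.
  by field; rewrite gt_eqF.
have p_le0 (a b : Z) : 0 < b -> num a b <= 0 -> p.[zr R a / zr R b] <= 0.
  move=> b0 /(ler_zr R); rewrite zr0 pE_frac // pmulr_lle0 //.
  by rewrite invr_gt0 exprn_gt0 // zr_gt0.
have p_ge0 (a b : Z) : 0 < b -> 0 <= num a b -> 0 <= p.[zr R a / zr R b].
  move=> b0 /(ler_zr R); rewrite zr0 pE_frac // pmulr_lge0 //.
  by rewrite invr_gt0 exprn_gt0 // zr_gt0.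
have [||x /andP[lox xhi] px] := @poly_ivt R p (decimal 1 lambda_lo) (decimal 1 lambda_hi).
- by rewrite /decimal /=; lra.
- rewrite !decimalE; apply/andP; split.
    by apply: p_le0; vm_compute.
  by apply: p_ge0; vm_compute.
exists x; first by rewrite lox.
have x0 : 0 < x by rewrite (lt_le_trans _ lox) // (lt_le_trans _ lo1).
split=> //; rewrite sum_Pdet_frac //; move/rootP: px; rewrite pE => /eqP.
by rewrite subr_eq0 => /eqP <-; rewrite divff // expf_neq0 // gt_eqF.
Qed.

Lemma Pdet_nil : [::] \notin Pdet.
Proof. by rewrite in_Pdet. Qed.

Lemma growth_param_Pdet (R : realType) :
  [/\ 0 < growth_param R Pdet,
      \sum_(w <- Pdet) growth_param R Pdet ^- size w = 1 &
      decimal 1 lambda_lo <= growth_param R Pdet <= decimal 1 lambda_hi].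
Proof.
have [x xb [x0 x1]] := exists_root_Pdet R.
have Pnil := Pdet_nil.
have -> : growth_param R Pdet = x.
  apply: xget_unique; first by split=> //; apply/growth_equationE.
  move=> y [y0 /(growth_equationE _ Pnil) y1].
  by apply: sum_Pdet_inj; rewrite ?x1.
by split.
Qed.

Lemma log2_growth_param_Pdet (R : realType) :
  decimal 0 [:: 7; 5; 6; 7; 0; 6; 6]%N <= log2 (growth_param R Pdet)
    <= decimal 0 [:: 7; 5; 6; 7; 0; 7]%N.
Proof.
have [l0 _ /andP[lo hi]] := growth_param_Pdet R; move: (growth_param R Pdet) => l in l0 lo hi *.
have lo0 : 0 < decimal 1 lambda_lo :> R by rewrite /decimal /=; lra.
(* Just below 2 / lambda, so that log2 lambda <= 1 - log2 y. *)
pose y : R := decimal 1 [:: 1; 8; 3; 6; 9; 1; 5; 8; 4; 6; 6; 0]%N.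
have y0 : 0 < y by rewrite /y /decimal /=; lra.
have y_ge : decimal 0 [:: 2; 4; 3; 2; 9; 3]%N <= log2 y.
  by apply: (@decimal_le_log2 _ _ _ _ 26); vm_compute.
apply/andP; split.
  apply: le_trans (ler_log2 lo0 lo).
  by apply: (@decimal_le_log2 _ _ _ _ 26); vm_compute.
have ly : l * y <= 2.
  apply: (@le_trans _ _ (decimal 1 lambda_hi * y)); first by rewrite ler_pM2r.
  by rewrite /y /decimal /=; lra.
have := ler_log2 (mulr_gt0 l0 y0) ly.
rewrite log2M // log2_2; move: (log2 l) (log2 y) y_ge => l' m.
by rewrite /decimal /=; lra.
Qed.

(** * The lower bound from the enlarged set *)

Lemma card_star_code_gt0 (P : {fset bitseq}) n : {subset Qdet_words <= P} ->
  (30 <= n)%N -> (0 < #|star_code P n|)%N.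
Proof.
move=> WP n30; pose u := nseq 6 false; pose v := [:: false; false; false; false; true; true; true].
(* Taking [n %% 6] words of length 7 leaves a multiple of 6. From 30 = (6-1)(7-1) on, every length
   is a sum of sixes and sevens. *)
pose w := flatten (nseq ((n - 7 * (n %% 6)) %/ 6) u ++ nseq (n %% 6) v).
have sw : size w == n.
  rewrite size_flatten /shape map_cat !map_nseq sumn_cat !sumn_nseq /=.
  by move: n30; clear; lia.
apply/card_gt0P; exists (Tuple sw); rewrite inE; apply/asboolP.
exists (nseq ((n - 7 * (n %% 6)) %/ 6) u ++ nseq (n %% 6) v) => // x.
by rewrite mem_cat !mem_nseq => /orP[]/andP[_ /eqP->]; apply: WP.
Qed.

Lemma Rdet2_ge_decimal (R : realType) :
  ((decimal 0 [:: 7; 5; 6; 7; 0; 7]%N : R)%:E <= Rdet2 R)%E.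
Proof.
have muE : 169%:R / 100%:R = decimal 1 [:: 6; 9; 0; 0; 0; 0; 0; 0]%N :> R.
  by rewrite /decimal /=; lra.
(* 1.69 lies between the growth parameters of [Pdet] and [Qdet], and its binary logarithm already
   exceeds 0.756707. *)
apply: (@le_trans _ _ (log2 (169%:R / 100%:R))%:E).
  by rewrite lee_fin muE; apply: (@decimal_le_log2 _ _ _ _ 16); vm_compute.
apply: (@Rdet2_ge _ Qdet 30).
- exact: prefix_free_Qdet.
- by rewrite in_Qdet.
- exact: detecting_Qdet.
- by move=> n; apply: card_star_code_gt0 => w; rewrite in_Qdet.
- by rewrite ler_pdivlMr ?ltr0n // mul1r ler_nat.
(* Numerator of the sum for [Qdet] at [a / b] over [a ^+ 11]; the coefficient 13 is 12 plus one for
   the added word of length 9. *)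
- pose num (a b : Z) : Z := 8 * a ^+ 5 * b ^+ 6 + 14 * a ^+ 4 * b ^+ 7
    + 12 * a ^+ 3 * b ^+ 8 + 13 * a ^+ 2 * b ^+ 9 + 4 * b ^+ 11.
  have a0 : 0 < zr R 169 by apply: zr_gt0; vm_compute.
  have b0 : 0 < zr R 100 by apply: zr_gt0; vm_compute.
  rewrite -(zr_nat R 169) -(zr_nat R 100) sum_Qdet sum_Pdet_frac ?divr_gt0 //.
  have -> : (zr R 169 / zr R 100) ^- 9 +
      (8 * (zr R 169 / zr R 100) ^+ 5 + 14 * (zr R 169 / zr R 100) ^+ 4 +
       12 * (zr R 169 / zr R 100) ^+ 3 + 12 * (zr R 169 / zr R 100) ^+ 2 + 4) /
      (zr R 169 / zr R 100) ^+ 11 = zr R (num 169 100) / zr R 169 ^+ 11.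
    have numE a b : zr R (num a b) = 8 * zr R a ^+ 5 * zr R b ^+ 6
        + 14 * zr R a ^+ 4 * zr R b ^+ 7 + 12 * zr R a ^+ 3 * zr R b ^+ 8
        + 13 * zr R a ^+ 2 * zr R b ^+ 9 + 4 * zr R b ^+ 11.
      by rewrite /num /zr; ring.
    rewrite numE; move: (zr R 169) (zr R 100) a0 b0 => a b a0 b0.
    by field; rewrite !gt_eqF.
  rewrite ler_pdivlMr ?exprn_gt0 // mul1r -zrX.
  by apply: ler_zr; vm_compute.
Qed.

Theorem mainTheorem5 (R : realType) :
  let equation (x : R) :=
    8 * x ^- 6 + 14 * x ^- 7 + 12 * x ^- 8 + 12 * x ^- 9 + 4 * x ^- 11 = 1 in
  let lambda : R := growth_param R Pdet in
  prefix_free Pdet /\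
  (word_count Pdet 6 = 8 /\ word_count Pdet 7 = 14 /\ word_count Pdet 8 = 12 /\
   word_count Pdet 9 = 12 /\ word_count Pdet 11 = 4 /\
   (forall l : nat, l \notin [:: 6; 7; 8; 9; 11] -> word_count Pdet l = 0))%N /\
  [/\ 0 < lambda, equation lambda &
      forall x : R, 0 < x -> equation x -> x = lambda] /\
  `|lambda - decimal 1 [:: 6; 8; 9; 6; 2; 9; 3; 1; 3; 8]%N| <= 5 / 10 ^+ 11 /\
  rate R Pdet = log2 lambda /\
  `|rate R Pdet - decimal 0 [:: 7; 5; 6; 7; 0; 7]%N| <= 5 / 10 ^+ 7 /\
  (forall n : nat, detecting (star_code Pdet n)) /\
  ((decimal 0 [:: 7; 5; 6; 7; 0; 7]%N : R)%:E <= Rdet2 R)%E /\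
  (Rdet2 R <= (1 / 2 * log2 (3 : R))%:E)%E /\
  `|1 / 2 * log2 (3 : R) - decimal 0 [:: 7; 9; 2; 4; 8; 1]%N| <= 5 / 10 ^+ 7.
Proof.
move=> equation lambda.
have [l0 l1 lb] := growth_param_Pdet R.
have countE l : word_count Pdet l = count (fun w => size w == l) Pdet_words.
  exact: (word_count_seq l in_Pdet).
split; first exact: prefix_free_Pdet.
split.
  rewrite !countE; do 5 (split; first by []).
  by move=> l l_notin; rewrite countE; apply/eqP; rewrite eqn0Ngt -has_count;
    apply: contra l_notin => /hasP[w wP /eqP <-]; move: w wP; apply/allP.
split.
  split=> // [|x x0 Ex]; first by rewrite /equation -sum_Pdet.
  by apply: sum_Pdet_inj; rewrite // l1 sum_Pdet.
split.
  move: lb; rewrite ler_norml -/lambda /decimal /= => /andP[lo hi].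
  by apply/andP; split; lra.
split=> //.
split.
  have /andP[lo hi] := log2_growth_param_Pdet R.
  rewrite ler_norml /rate; move: (log2 _) lo hi => r.
  by rewrite /decimal /= => lo hi; apply/andP; split; lra.
split; first exact: detecting_Pdet.
split; first exact: Rdet2_ge_decimal.
by split; [exact: Rdet2_le_log3|exact: half_log2_3].
Qed.
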